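(* Let $X$ be a topological space. If $\widetilde X_{top}=\widetilde X_{wh}$ (that is, the two topologies on $\widetilde X$ coincide) for every choice of base point $x_0\in X$, then $X$ is a small loop transfer space.
   Context: Let $I=[0,1]$. For $x_0\in X$, $\widetilde X$ is the set of homotopy classes $[\alpha]$ (rel. end-points) of paths $\alpha\colon I\to X$ with $\alpha(0)=x_0$. $\widetilde X_{top}$ is $\widetilde X$ with the quotient topology from the space $(X,x_0)^{(I,0)}$ of paths in $X$ starting at $x_0$, equipped with the compact-open topology, under $\alpha\mapsto[\alpha]$. $\widetilde X_{wh}$ is $\widetilde X$ with the whisker topology, which has basis $B([\alpha],U)=\{[\alpha\ast\beta]\}$, where $\alpha$ is a path in $X$ from $x_0$ to $x_1$, $U$ is a neighborhood of $x_1$ in $X$, and $\beta$ ranges over paths in $U$ originating at $x_1$. A topological space $X$ is a small loop transfer space (SLT-space) if for every path $\alpha$ in $X$ and every neighborhood $U$ of $x_0=\alpha(0)$ there is a neighborhood $V$ of $x_1=\alpha(1)$ such that given a loop $\beta\colon(S^1,1)\to(V,x_1)$ there is a loop $\gamma\colon(S^1,1)\to(U,x_0)$ that is homotopic in $X$ to $\alpha\ast\beta\ast\alpha^{-1}$ rel. $x_0$. *)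

(* Defs.v *)
From HB Require Import structures.
From mathcomp Require Import all_boot all_order all_algebra generic_quotient.
From mathcomp Require Import all_classical all_reals all_analysis.
From mathcomp Require Import homotopy.
From mathcomp Require Import lra.

Set Implicit Arguments.
Unset Strict Implicit.
Unset Printing Implicit Defensive.

Import Order.TTheory GRing.Theory Num.Theory.
Import numFieldNormedType.Exports.

Local Open Scope classical_set_scope.
Local Open Scope ring_scope.
Local Open Scope quotient_scope.

Section UnitInterval.
Context (R : realType).

Definition unitI : Type := set_type `[0 : R, 1]%classic.

HB.instance Definition _ := Topological.copy unitI (set_type `[0 : R, 1]%classic).

(* clamp retracts the real line onto the unit interval; path_cat and path_rev
   only apply it to reals that already lie in the interval. *)
Lemma clampP (r : R) : Num.max 0 (Num.min 1 r) \in `[0 : R, 1]%classic.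
Proof. by rewrite inE/= in_itv/= le_max lexx ge_max ler01 ge_min lexx. Qed.

Definition clamp (r : R) : unitI := @exist R (fun x => x \in _) _ (clampP r).

Definition unitI_val (t : unitI) : R := set_val t.

Lemma unitI_ge0 (t : unitI) : 0 <= unitI_val t.
Proof. by have := set_valP t; rewrite /= in_itv/= => /andP[]. Qed.

Lemma unitI_le1 (t : unitI) : unitI_val t <= 1.
Proof. by have := set_valP t; rewrite /= in_itv/= => /andP[]. Qed.

Lemma unitI_inj (s t : unitI) : unitI_val s = unitI_val t -> s = t.
Proof. exact: val_inj. Qed.

Lemma clampK (r : R) : 0 <= r <= 1 -> unitI_val (clamp r) = r.
Proof. by case/andP=> r0 r1; rewrite /unitI_val set_valE/= min_r// max_r. Qed.

Lemma unitI_valK (t : unitI) : clamp (unitI_val t) = t.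
Proof. by apply: unitI_inj; rewrite clampK// unitI_ge0 unitI_le1. Qed.

Lemma clamp0_neq1 : clamp 0 != clamp 1.
Proof.
apply/eqP => /(congr1 unitI_val); rewrite !clampK ?lexx ?ler01// => /eqP.
by rewrite eq_sym oner_eq0.
Qed.

HB.instance Definition _ := isBiPointed.Build unitI clamp0_neq1.

Lemma val_zero : unitI_val zero = 0.
Proof. by rewrite clampK// lexx ler01. Qed.

Lemma val_one : unitI_val one = 1.
Proof. by rewrite clampK// lexx ler01. Qed.

Lemma unitI_val_continuous : continuous unitI_val.
Proof. exact: initial_continuous. Qed.

Lemma clamp_continuous : continuous clamp.
Proof.
apply: continuous_comp_initial => r.
apply: (@continuous_max R R (cst 0) (fun r => Num.min 1 r)); first exact: cvg_cst.
by apply: (@continuous_min R R (cst 1) id); [exact: cvg_cst|exact: cvg_id].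
Qed.

Lemma clamp0 : clamp 0 = zero.
Proof. by []. Qed.

Lemma clamp1 : clamp 1 = one.
Proof. by []. Qed.

Lemma clamp_ge1 (r : R) : 1 <= r -> clamp r = one.
Proof.
move=> r1; apply: unitI_inj.
by rewrite val_one /unitI_val set_valE/= min_l// max_r.
Qed.

End UnitInterval.

Lemma comp_continuous (S T U : topologicalType) (f : T -> U) (g : S -> T) :
  continuous g -> continuous f -> continuous (fun z => f (g z)).
Proof. by move=> cg cf z; apply: continuous_comp; [exact: cg|exact: cf]. Qed.

Section Paths.
Context (R : realType) (X : topologicalType).
Local Notation I := (unitI R).

Definition path_cat (f g : I -> X) : I -> X := fun t =>
  if unitI_val t <= 2^-1 then f (clamp (2 * unitI_val t))
  else g (clamp (2 * unitI_val t - 1)).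

Definition path_rev (f : I -> X) : I -> X := fun t => f (clamp (1 - unitI_val t)).

(* Homotopy rel end-points: the second coordinate is the time. The stationary
   end-points force f and g to have the same end-points. *)
Definition path_homotopic (f g : I -> X) := exists H : I * I -> X,
  [/\ continuous H,
      forall s, H (s, zero) = f s,
      forall s, H (s, one) = g s &
      forall t, H (zero, t) = f zero /\ H (one, t) = f one].

Lemma path_homotopic0 (f g : I -> X) : path_homotopic f g -> f zero = g zero.
Proof. by case=> H [_ _ Hg H01]; rewrite -Hg (H01 one).1. Qed.

Lemma path_homotopic1 (f g : I -> X) : path_homotopic f g -> f one = g one.
Proof. by case=> H [_ _ Hg H01]; rewrite -Hg (H01 one).2. Qed.

Lemma path_homotopic_refl (f : I -> X) : continuous f -> path_homotopic f f.
Proof.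
move=> cf; exists (f \o fst); split=> //.
by apply: (comp_continuous _ cf) => z; exact: cvg_fst.
Qed.

Lemma clamp_comp_continuous (T : topologicalType) (g : T -> R) :
  continuous g -> continuous (fun z => clamp (g z)).
Proof.
by move=> cg; apply: (comp_continuous cg); exact: clamp_continuous.
Qed.

Lemma pasting (T : topologicalType) (h : T -> R) (c : R) (f g : T -> X) :
  continuous h -> continuous f -> continuous g ->
  (forall z, h z = c -> f z = g z) ->
  continuous (fun z => if h z <= c then f z else g z).
Proof.
move=> ch cf cg fg.
have cont_closed (A : set R) : closed A -> closed (h @^-1` A).
  by move: ch => /continuous_closedP; apply.
apply/continuous_subspace_setT.
have -> : [set: T] = [set z | h z <= c] `|` [set z | h z >= c].
  rewrite eqEsubset; split=> z // _.
  by case: (leP (h z) c) => [|/ltW]; [left|right].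
apply: withinU_continuous.
- exact: (cont_closed _ (@closed_le R c)).
- exact: (cont_closed _ (@closed_ge R c)).
- apply: (subspace_eq_continuous _ (continuous_subspaceT cf)).
  by move=> z; rewrite inE/= /from_subspace => ->.
- apply: (subspace_eq_continuous _ (continuous_subspaceT cg)).
  move=> z; rewrite inE/= /from_subspace => hz; case: ifPn => // hz'; apply/esym.
  by apply: fg; apply/eqP; rewrite eq_le hz' hz.
Qed.

Lemma pair_comp_continuous (S T : topologicalType) (H : I * S -> X)
    (a : T -> I) (b : T -> S) : continuous H -> continuous a ->
  continuous b -> continuous (fun z => H (a z, b z)).
Proof.
move=> cH ca cb; apply: (comp_continuous _ cH) => z.
by apply: (@cvg_pair _ _ _ (nbhs z) (nbhs (a z)) (nbhs (b z))); [exact: ca|exact: cb].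
Qed.

Lemma fst_unitI_continuous (T : topologicalType) :
  continuous (fun z : I * T => unitI_val z.1).
Proof.
by apply: (comp_continuous _ (@unitI_val_continuous R)) => z; exact: cvg_fst.
Qed.

Lemma snd_unitI_continuous (T : topologicalType) :
  continuous (fun z : T * I => unitI_val z.2).
Proof.
by apply: (comp_continuous _ (@unitI_val_continuous R)) => z; exact: cvg_snd.
Qed.

Lemma affine_continuous (T : topologicalType) (h : T -> R) (a b : R) :
  continuous h -> continuous (fun z => a * h z + b).
Proof.
by move=> ch z; apply: cvgD; [apply: cvgM; [exact: cvg_cst|exact: ch]|exact: cvg_cst].
Qed.

Lemma scale_continuous (T : topologicalType) (h : T -> R) (a : R) :
  continuous h -> continuous (fun z => a * h z).
Proof. by move=> ch z; apply: cvgM; [exact: cvg_cst|exact: ch]. Qed.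

Lemma addcst_continuous (T : topologicalType) (h : T -> R) (b : R) :
  continuous h -> continuous (fun z => h z + b).
Proof. by move=> ch z; apply: cvgD; [exact: ch|exact: cvg_cst]. Qed.

Lemma oppr1_continuous (T : topologicalType) (h : T -> R) :
  continuous h -> continuous (fun z => 1 - h z).
Proof. by move=> ch z; apply: cvgB; [exact: cvg_cst|exact: ch]. Qed.

Lemma path_cat_continuous (f g : I -> X) : continuous f -> continuous g ->
  f one = g zero -> continuous (path_cat f g).
Proof.
move=> cf cg fg; apply: pasting.
- exact: unitI_val_continuous.
- apply: (comp_continuous _ cf); apply: clamp_comp_continuous.
  exact/scale_continuous/unitI_val_continuous.
- apply: (comp_continuous _ cg); apply: clamp_comp_continuous.
  exact/affine_continuous/unitI_val_continuous.
- move=> z ->; rewrite divff ?pnatr_eq0// subrr; exact: fg.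
Qed.

Lemma path_rev_continuous (f : I -> X) : continuous f -> continuous (path_rev f).
Proof.
move=> cf; apply: (comp_continuous _ cf); apply: clamp_comp_continuous.
exact/oppr1_continuous/unitI_val_continuous.
Qed.

Lemma path_cat0 (f g : I -> X) : path_cat f g zero = f zero.
Proof. by rewrite /path_cat val_zero invr_ge0 ler0n mulr0 clamp0. Qed.

Lemma path_cat1 (f g : I -> X) : path_cat f g one = g one.
Proof.
rewrite /path_cat val_one ifF ?mulr1; last by apply/negbTE; rewrite -ltNge; lra.
by congr g; rewrite -clamp1; congr clamp; lra.
Qed.

Lemma path_rev0 (f : I -> X) : path_rev f zero = f one.
Proof. by rewrite /path_rev val_zero subr0 clamp1. Qed.

Lemma path_rev1 (f : I -> X) : path_rev f one = f zero.
Proof. by rewrite /path_rev val_one subrr clamp0. Qed.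

Lemma path_homotopic_sym (f g : I -> X) : path_homotopic f g -> path_homotopic g f.
Proof.
move=> fg; have [f0g0 f1g1] := (path_homotopic0 fg, path_homotopic1 fg).
case: fg => H [cH Hf Hg H01].
exists (fun z => H (z.1, clamp (1 - unitI_val z.2))); split.
- apply: (pair_comp_continuous cH); first by move=> z; exact: cvg_fst.
  exact/clamp_comp_continuous/oppr1_continuous/snd_unitI_continuous.
- by move=> s; rewrite /= val_zero subr0 clamp1.
- by move=> s; rewrite /= val_one subrr clamp0.
- by move=> t; rewrite /= -f0g0 -f1g1; exact: H01.
Qed.

Lemma path_homotopic_trans (f g h : I -> X) :
  path_homotopic f g -> path_homotopic g h -> path_homotopic f h.
Proof.
move=> fg; have [f0g0 f1g1] := (path_homotopic0 fg, path_homotopic1 fg).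
case: fg => H [cH Hf Hg H01] [K [cK Kg Kh K01]].
exists (fun z => if unitI_val z.2 <= 2^-1
  then H (z.1, clamp (2 * unitI_val z.2))
  else K (z.1, clamp (2 * unitI_val z.2 - 1))); split.
- apply: pasting.
  + exact: snd_unitI_continuous.
  + apply: (pair_comp_continuous cH); first by move=> z; exact: cvg_fst.
    exact/clamp_comp_continuous/scale_continuous/snd_unitI_continuous.
  + apply: (pair_comp_continuous cK); first by move=> z; exact: cvg_fst.
    exact/clamp_comp_continuous/affine_continuous/snd_unitI_continuous.
  + by move=> z ->; rewrite divff ?pnatr_eq0// subrr clamp1 clamp0 Hg Kg.
- by move=> s; rewrite /= val_zero invr_ge0 ler0n mulr0 clamp0.
- move=> s; rewrite /= val_one ifF; last by apply/negbTE; rewrite -ltNge; lra.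
  by rewrite -Kh; congr (K (_, _)); rewrite -clamp1; congr clamp; lra.
- move=> t /=; case: ifPn => _; first exact: H01.
  by rewrite f0g0 f1g1; exact: K01.
Qed.

Lemma path_homotopic_cat (f f' g g' : I -> X) : f one = g zero ->
  path_homotopic f f' -> path_homotopic g g' ->
  path_homotopic (path_cat f g) (path_cat f' g').
Proof.
move=> fg [H [cH Hf Hf' H01]] [K [cK Kg Kg' K01]].
exists (fun z => if unitI_val z.1 <= 2^-1
  then H (clamp (2 * unitI_val z.1), z.2)
  else K (clamp (2 * unitI_val z.1 - 1), z.2)); split.
- apply: pasting.
  + exact: fst_unitI_continuous.
  + apply: (pair_comp_continuous cH); last by move=> z; exact: cvg_snd.
    exact/clamp_comp_continuous/scale_continuous/fst_unitI_continuous.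
  + apply: (pair_comp_continuous cK); last by move=> z; exact: cvg_snd.
    exact/clamp_comp_continuous/affine_continuous/fst_unitI_continuous.
  + move=> z ->; rewrite divff ?pnatr_eq0// subrr clamp1 clamp0.
    by rewrite (H01 _).2 (K01 _).1.
- by move=> s; rewrite /path_cat/= Hf Kg.
- by move=> s; rewrite /path_cat/= Hf' Kg'.
- move=> t; rewrite path_cat0 path_cat1 /= val_zero invr_ge0 ler0n mulr0 clamp0.
  rewrite (H01 _).1 val_one ifF; last by apply/negbTE; rewrite -ltNge; lra.
  by split=> //; rewrite -(K01 t).2; congr (K (_, _)); rewrite -clamp1; congr clamp; lra.
Qed.

Lemma path_homotopic_reparam (f : I -> X) (phi psi : I -> I) :
  continuous f -> continuous phi -> continuous psi ->
  phi zero = psi zero -> phi one = psi one ->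
  path_homotopic (f \o phi) (f \o psi).
Proof.
move=> cf cphi cpsi e0 e1.
have cc (chi : I -> I) : continuous chi ->
    continuous (fun z : I * I => unitI_val (chi z.1)).
  move=> cchi; apply: (comp_continuous _ (@unitI_val_continuous R)).
  by apply: (comp_continuous _ cchi) => z; exact: cvg_fst.
exists (fun z => f (clamp ((1 - unitI_val z.2) * unitI_val (phi z.1)
  + unitI_val z.2 * unitI_val (psi z.1)))); split.
- apply: (comp_continuous _ cf); apply: clamp_comp_continuous => z.
  apply: cvgD; apply: cvgM; [|exact: cc| |exact: cc].
    exact: oppr1_continuous (@snd_unitI_continuous _) z.
  exact: snd_unitI_continuous.
- by move=> s; rewrite /= val_zero subr0 mul1r mul0r addr0 unitI_valK.
- by move=> s; rewrite /= val_one subrr mul1r mul0r add0r unitI_valK.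
- by move=> t; rewrite /= e0 e1 -!mulrDl subrK !mul1r !unitI_valK.
Qed.

Lemma path_homotopic_catr1 (f : I -> X) : continuous f ->
  path_homotopic (path_cat f (cst (f one))) f.
Proof.
move=> cf; have -> : path_cat f (cst (f one)) =
    f \o (fun t : I => clamp (2 * unitI_val t)).
  apply/funext => t; rewrite /path_cat/=; case: ifPn => //; rewrite -ltNge => lt.
  by rewrite clamp_ge1//; lra.
have -> : path_homotopic (f \o (fun t : I => clamp (2 * unitI_val t))) f =
    path_homotopic (f \o (fun t : I => clamp (2 * unitI_val t))) (f \o id).
  by [].
apply: path_homotopic_reparam => //.
- exact/clamp_comp_continuous/scale_continuous/unitI_val_continuous.
- by move=> t; exact: cvg_id.
- by rewrite val_zero mulr0.
- by rewrite val_one mulr1 clamp_ge1// ler1n.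
Qed.

Lemma path_homotopic_catA (f g h : I -> X) :
  continuous f -> continuous g -> continuous h ->
  f one = g zero -> g one = h zero ->
  path_homotopic (path_cat (path_cat f g) h) (path_cat f (path_cat g h)).
Proof.
move=> cf cg ch fg gh.
pose q (x : R) := Num.min (2 * x) (Num.min (x + 4^-1) (2^-1 * x + 2^-1)).
pose phi (t : I) := clamp (q (unitI_val t)).
have q01 (t : I) : 0 <= q (unitI_val t) <= 1.
  have := unitI_ge0 t; have := unitI_le1 t; move: (unitI_val t) => x x1 x0.
  rewrite /q; apply/andP; split; first by rewrite !le_min; do !(apply/andP; split); lra.
  by rewrite !ge_min; apply/orP; right; apply/orP; right; lra.
have -> : path_cat (path_cat f g) h = path_cat f (path_cat g h) \o phi.
  apply/funext => t /=; rewrite /path_cat /phi (clampK (q01 t)).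
  have := q01 t; rewrite /q.
  have := unitI_ge0 t; have := unitI_le1 t; move: (unitI_val t) => x x1 x0 q1.
  have [lt2|gt2] := leP x 2^-1.
    rewrite clampK; last by lra.
    have [lt4|gt4] := leP (2 * x) 2^-1.
      have E : Num.min (2 * x) (Num.min (x + 4^-1) (2^-1 * x + 2^-1)) = 2 * x.
        by apply/min_idPl; rewrite le_min; apply/andP; split; lra.
      by rewrite E lt4.
    have E : Num.min (2 * x) (Num.min (x + 4^-1) (2^-1 * x + 2^-1)) = x + 4^-1.
      have -> : Num.min (x + 4^-1) (2^-1 * x + 2^-1) = x + 4^-1.
        by apply/min_idPl; lra.
      by apply/min_idPr; lra.
    rewrite E ifF; last by apply/negbTE; rewrite -ltNge; lra.
    rewrite clampK; last by lra.
    rewrite ifT; last by lra.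
    by congr (g (clamp _)); lra.
  have E : Num.min (2 * x) (Num.min (x + 4^-1) (2^-1 * x + 2^-1)) = 2^-1 * x + 2^-1.
    have -> : Num.min (x + 4^-1) (2^-1 * x + 2^-1) = 2^-1 * x + 2^-1.
      by apply/min_idPr; lra.
    by apply/min_idPr; lra.
  rewrite E clampK; last by lra.
  rewrite ifF; last by apply/negbTE; rewrite -ltNge; lra.
  rewrite ifF; last by apply/negbTE; rewrite -ltNge; lra.
  by congr (h (clamp _)); lra.
have -> : path_homotopic (path_cat f (path_cat g h) \o phi)
    (path_cat f (path_cat g h)) =
  path_homotopic (path_cat f (path_cat g h) \o phi)
    (path_cat f (path_cat g h) \o id) by [].
apply: path_homotopic_reparam => //.
- by apply: path_cat_continuous; rewrite ?path_cat0//; exact: path_cat_continuous.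
- apply: clamp_comp_continuous => t.
  apply: (@continuous_min R I (fun t => 2 * unitI_val t)
    (fun t => Num.min (unitI_val t + 4^-1) (2^-1 * unitI_val t + 2^-1))).
    exact: scale_continuous (@unitI_val_continuous R) t.
  apply: (@continuous_min R I (fun t => unitI_val t + 4^-1)
    (fun t => 2^-1 * unitI_val t + 2^-1)).
    exact: addcst_continuous (@unitI_val_continuous R) t.
  exact: affine_continuous (@unitI_val_continuous R) t.
- by move=> t; exact: cvg_id.
- apply: unitI_inj; rewrite /phi (clampK (q01 _)) val_zero /q mulr0.
  by apply/min_idPl; rewrite le_min; apply/andP; split; lra.
- apply: unitI_inj; rewrite /phi (clampK (q01 _)) val_one /q.
  have -> : Num.min (1 + 4^-1) (2^-1 * 1 + 2^-1) = 2^-1 * 1 + 2^-1 :> R.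
    by apply/min_idPr; lra.
  by rewrite min_r; lra.
Qed.

End Paths.

Section BasedPaths.
Context (R : realType) (X : topologicalType) (x0 : X).
Local Notation I := (unitI R).

(* Paths in X, as continuous maps on the unit interval, with the compact-open
   topology; based_path is the subspace of those that start at x0. *)
Definition path_space : Type := initial_topology
  (id : continuousType I X -> {compact-open, I -> X}).

HB.instance Definition _ := Topological.on path_space.

Definition based_path : Type :=
  set_type [set f : path_space | (f : continuousType I X) zero = x0].

HB.instance Definition _ := Topological.copy based_path
  (set_type [set f : path_space | (f : continuousType I X) zero = x0]).

Definition based_fun (f : based_path) : continuousType I X := set_val f.

Lemma based_fun0 (f : based_path) : based_fun f zero = x0.
Proof. exact: (set_valP f). Qed.

Lemma based_fun_continuous (f : based_path) : continuous (based_fun f).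
Proof. exact: cts_fun. Qed.

Definition mk_based (f : I -> X) (cf : continuous f) (f0 : f zero = x0) :
    based_path :=
  @exist path_space (fun f => f \in _) (mkcts cf : continuousType I X)
    (mem_set f0).

Lemma mk_basedE (f : I -> X) (cf : continuous f) (f0 : f zero = x0) :
  based_fun (mk_based cf f0) = f :> (I -> X).
Proof. by []. Qed.

HB.instance Definition _ := isPointed.Build based_path
  (mk_based (@cst_continuous I X x0) erefl).

Definition based_homotopic : rel based_path :=
  fun f g => `[< path_homotopic (based_fun f) (based_fun g) >].

Lemma based_homotopic_refl : reflexive based_homotopic.
Proof. by move=> f; apply/asboolP/path_homotopic_refl/based_fun_continuous. Qed.

Lemma based_homotopic_sym : symmetric based_homotopic.
Proof. by move=> f g; apply/asboolP/asboolP => /path_homotopic_sym. Qed.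

Lemma based_homotopic_trans : transitive based_homotopic.
Proof.
move=> g f h /asboolP fg /asboolP gh; apply/asboolP.
exact: path_homotopic_trans fg gh.
Qed.

Definition based_homotopic_equiv := EquivRel based_homotopic
  based_homotopic_refl based_homotopic_sym based_homotopic_trans.

Definition homotopy_class : Type := {eq_quot based_homotopic_equiv}.

HB.instance Definition _ := Choice.on homotopy_class.
HB.instance Definition _ := EqQuotient.on homotopy_class.

Definition class_of (f : based_path) : homotopy_class := \pi_homotopy_class f.

Lemma class_of_eq (f g : based_path) :
  class_of f = class_of g <-> path_homotopic (based_fun f) (based_fun g).
Proof.
split=> [/eqquotP/asboolP//|fg].
by apply/eqquotP/asboolP.
Qed.

Definition based_cat (f : based_path) (y : X)
    (g : {path I from based_fun f one to y in X}) : based_path :=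
  mk_based
    (path_cat_continuous (@based_fun_continuous f) (@cts_fun _ _ g)
      (esym (@path_zero _ _ _ _ g)))
    (etrans (path_cat0 (based_fun f) g) (based_fun0 f)).

Definition whisker_ball (f : based_path) (U : set X) : set homotopy_class :=
  [set c | exists y (g : {path I from based_fun f one to y in X}),
    range g `<=` U /\ c = class_of (based_cat g)].

Lemma whisker_ball_center (f : based_path) (U : set X) :
  U (based_fun f one) -> whisker_ball f U (class_of f).
Proof.
move=> Uf; exists (based_fun f one), (cst (based_fun f one)); split.
  by move=> _ [t _ <-].
apply/class_of_eq/path_homotopic_sym; rewrite mk_basedE.
exact/path_homotopic_catr1/based_fun_continuous.
Qed.

Lemma whisker_ball_trans (f h : based_path) (U V : set X) :
  whisker_ball f U (class_of h) -> V `<=` U ->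
  whisker_ball h V `<=` whisker_ball f U.
Proof.
move=> [y [g [gU /class_of_eq]]]; rewrite mk_basedE => hfg VU.
move=> _ [z [k [kV ->]]].
have g0 : g zero = based_fun f one by exact: (@path_zero _ _ _ _ g).
have g1 : g one = y by exact: (@path_one _ _ _ _ g).
have k1 : k one = z by exact: (@path_one _ _ _ _ k).
have y_h : based_fun h one = y by rewrite (path_homotopic1 hfg) path_cat1.
have k0 : k zero = based_fun h one by exact: (@path_zero _ _ _ _ k).
have gk : g one = k zero by rewrite k0 y_h.
have cgk : continuous (path_cat g k) by apply: path_cat_continuous => //; exact: cts_fun.
have gk0 : path_cat g k zero = based_fun f one by rewrite path_cat0.
have gk1 : path_cat g k one = z by rewrite path_cat1.
exists z, (mk_path cgk gk0 gk1); split.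
  move=> _ [t _ <-]; change (U (path_cat g k t)).
  rewrite /path_cat; case: ifPn => _.
    by apply: gU; exists (clamp (2 * unitI_val t)).
  by apply/VU/kV; exists (clamp (2 * unitI_val t - 1)).
apply/class_of_eq.
change (path_homotopic (path_cat (based_fun h) k)
  (path_cat (based_fun f) (path_cat g k))).
apply: (@path_homotopic_trans _ _ _ (path_cat (path_cat (based_fun f) g) k)).
  apply: path_homotopic_cat => //.
  exact/path_homotopic_refl/cts_fun.
by apply: path_homotopic_catA => //; exact: cts_fun.
Qed.

Lemma whisker_ball_end (f h : based_path) (U : set X) :
  whisker_ball f U (class_of h) -> U (based_fun h one).
Proof.
move=> [y [g [gU /class_of_eq]]]; rewrite mk_basedE => /path_homotopic1 ->.
by rewrite path_cat1; apply: gU; exists one.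
Qed.

Lemma class_of_surj (c : homotopy_class) : exists f, c = class_of f.
Proof. by exists (repr c); rewrite /class_of reprK. Qed.

Definition universal_top : Type := quotient_topology homotopy_class.

HB.instance Definition _ := Topological.on universal_top.

(* The balls B([f], U) with U an open neighborhood of the end-point of f form
   a base; with arbitrary neighborhoods U they would not consist of open
   sets. *)
Definition universal_wh : Type := homotopy_class.

HB.instance Definition _ := Choice.on universal_wh.

Let whisker_index : set (based_path * set X) :=
  [set fU | open fU.2 /\ fU.2 (based_fun fU.1 one)].

Let whisker_base (fU : based_path * set X) : set universal_wh :=
  whisker_ball fU.1 fU.2.

Let whisker_cover : \bigcup_(fU in whisker_index) whisker_base fU = setT.
Proof.
rewrite eqEsubset; split=> // c _; have [f ->] := class_of_surj c.
exists (f, setT); first by split=> //; exact: openT.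
exact: whisker_ball_center.
Qed.

Let whisker_join (fU gV : based_path * set X) (c : universal_wh) :
  whisker_index fU -> whisker_index gV -> whisker_base fU c ->
  whisker_base gV c -> exists hW,
  [/\ whisker_index hW, whisker_base hW c &
     whisker_base hW `<=` whisker_base fU `&` whisker_base gV].
Proof.
move: fU gV => [f U] [g V] [/= oU Uf] [/= oV Vg].
have [h ->] := class_of_surj c; rewrite /whisker_base /= => fUh gVh.
have Uh := whisker_ball_end fUh; have Vh := whisker_ball_end gVh.
exists (h, U `&` V); split=> /=.
- by split=> //; exact: openI.
- exact: whisker_ball_center.
- rewrite subsetI; split.
    by apply: whisker_ball_trans fUh _; exact: subIsetl.
  by apply: whisker_ball_trans gVh _; exact: subIsetr.
Qed.

HB.instance Definition _ := isBaseTopological.Build universal_wh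
  whisker_cover whisker_join.

End BasedPaths.

(* A loop (S^1, 1) -> (X, x) is read as a path from x to x, so that it can be
   concatenated with paths; homotopy rel x is then homotopy rel end-points. *)
Definition small_loop_transfer (R : realType) (X : topologicalType) : Prop :=
  forall (x0 x1 : X) (alpha : {path (unitI R) from x0 to x1 in X}) (U : set X),
    nbhs x0 U -> exists2 V : set X, nbhs x1 V &
      forall beta : {path (unitI R) from x1 to x1 in X}, range beta `<=` V ->
      exists2 gamma : {path (unitI R) from x0 to x0 in X}, range gamma `<=` U &
        path_homotopic gamma
          (path_cat (path_cat alpha beta) (path_rev alpha)).

(* Main.v *)
Require Import Defs.
From mathcomp Require Import all_boot all_order all_algebra.
From mathcomp Require Import all_classical all_reals all_analysis.
From mathcomp Require Import homotopy.
From mathcomp Require Import lra.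

(** Let [a] be the reverse of the path [alpha], so [a] runs from [x1] to [x0].
    For [U] open, the whisker ball [B([a], U)] is open in the whisker topology
    based at [x1]; by hypothesis it is open in the quotient topology, so the
    paths whose class lies in it form a compact-open neighborhood of [a].

    A loop [beta] at [x1] perturbs [a] only slightly in the compact-open
    topology when it is run through very fast before [a]: such a path is [a]
    itself outside a short initial interval, on which it stays in any given
    neighborhood of [x1] as soon as [beta] does ([nbhs_delayed_cat]). Hence some
    neighborhood [V] of [x1] and some speed work for every [beta] in [V] at
    once. Speed does not affect the homotopy class, so
    [beta * a ~ a * gamma] for a path [gamma] in [U]; comparing
    end-points, [gamma] is a loop at [x0]. Composing with [alpha] on the left
    cancels [a] and gives [alpha * beta * a ~ gamma], the transfer of [beta]
    along [alpha]. *)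

Set Implicit Arguments.
Unset Strict Implicit.
Unset Printing Implicit Defensive.

Import Order.TTheory GRing.Theory Num.Theory.
Import numFieldNormedType.Exports.

Local Open Scope classical_set_scope.
Local Open Scope ring_scope.

(** * Cancellation in the path groupoid *)

Section PathGroupoid.
Context (R : realType) (X : topologicalType).
Local Notation I := (unitI R).
Implicit Types f g : I -> X.

Lemma clamp_le0 (r : R) : r <= 0 -> clamp r = zero.
Proof.
move=> r0; apply: unitI_inj; rewrite val_zero /unitI_val set_valE/=.
have r1 : r <= 1 by lra.
by rewrite (min_r r1) (max_l r0).
Qed.

(** The constant path followed by [f] is a reparametrization of [f]. *)
Lemma path_homotopic_catl1 f : continuous f ->
  path_homotopic (path_cat (cst (f zero)) f) f.
Proof.
move=> cf; have -> : path_cat (cst (f zero)) f =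
    f \o (fun t : I => clamp (2 * unitI_val t - 1)).
  apply/funext => t; rewrite /path_cat/=; case: ifPn => // le.
  by rewrite clamp_le0//; lra.
change (path_homotopic (f \o (fun t : I => clamp (2 * unitI_val t - 1)))
  (f \o id)).
apply: path_homotopic_reparam => //.
- exact/clamp_comp_continuous/affine_continuous/unitI_val_continuous.
- by move=> t; exact: cvg_id.
- by rewrite val_zero clamp_le0//; lra.
- by rewrite val_one clamp_ge1//; lra.
Qed.

(** Both sides are [f] composed with loops at 0 in the unit interval, which is
    convex. *)
Lemma path_homotopic_catV f : continuous f ->
  path_homotopic (path_cat f (path_rev f)) (cst (f zero)).
Proof.
move=> cf.
pose phi (t : I) := clamp (Num.min (2 * unitI_val t) (-2 * unitI_val t + 2)).
have -> : path_cat f (path_rev f) = f \o phi.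
  apply/funext => t; rewrite /path_cat /path_rev /phi /=.
  have := unitI_ge0 t; have := unitI_le1 t; move: (unitI_val t) => x x1 x0.
  case: leP => le.
    by rewrite min_l//; lra.
  rewrite clampK; last by lra.
  by rewrite min_r; last lra; congr (f (clamp _)); lra.
change (path_homotopic (f \o phi) (f \o cst zero)).
apply: path_homotopic_reparam => //.
- apply: clamp_comp_continuous => t.
  apply: (@continuous_min R I (fun t => 2 * unitI_val t)
    (fun t => -2 * unitI_val t + 2)).
    exact: Defs.scale_continuous (@unitI_val_continuous R) t.
  exact: affine_continuous (@unitI_val_continuous R) t.
- exact: cst_continuous.
- by rewrite /phi val_zero !mulr0 add0r min_l//; lra.
- by rewrite /phi val_one min_r ?mulr1; last lra; rewrite /= addNr.
Qed.

(** Composing the hypothesis with [f] on the left cancels the [path_rev f] in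
    front of [c]. *)
Lemma path_homotopic_transfer (f b c : I -> X) :
  continuous f -> continuous b -> continuous c ->
  f one = b zero -> b one = f one -> c zero = f zero ->
  path_homotopic (path_cat b (path_rev f)) (path_cat (path_rev f) c) ->
  path_homotopic c (path_cat (path_cat f b) (path_rev f)).
Proof.
move=> cf cb cc fb bf cf0 hom.
have cr := path_rev_continuous cf.
apply: (@path_homotopic_trans _ _ _ (path_cat (cst (c zero)) c)).
  exact/path_homotopic_sym/path_homotopic_catl1.
apply: (@path_homotopic_trans _ _ _ (path_cat (path_cat f (path_rev f)) c)).
  apply: path_homotopic_cat => //; last exact: path_homotopic_refl.
  by rewrite cf0; exact/path_homotopic_sym/path_homotopic_catV.
apply: (@path_homotopic_trans _ _ _ (path_cat f (path_cat (path_rev f) c))).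
  by apply: path_homotopic_catA; rewrite ?path_rev0 ?path_rev1.
apply: (@path_homotopic_trans _ _ _ (path_cat f (path_cat b (path_rev f)))).
  apply: path_homotopic_cat; last exact: path_homotopic_sym.
    by rewrite path_cat0 path_rev0.
  exact: path_homotopic_refl.
apply/path_homotopic_sym/path_homotopic_catA => //.
by rewrite path_rev0.
Qed.

End PathGroupoid.

(** * Running through a loop fast *)

Section DelayedPath.
Context (R : realType) (X : topologicalType).
Local Notation I := (unitI R).
Implicit Types (n : nat) (t : I) (a b : I -> X).

(** Precomposing [path_cat b a] with this map runs through [b] at speed
    [2 * n.+1] and through the beginning of [a] quickly until it catches up with
    [a] itself: the second branch of the minimum inverts the parametrization of
    the second half of [path_cat]. *)
Definition delay n t : I :=
  clamp (Num.min (n.+1%:R * unitI_val t) (2^-1 * unitI_val t + 2^-1)).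

Lemma delay_bound n t :
  0 <= Num.min (n.+1%:R * unitI_val t) (2^-1 * unitI_val t + 2^-1) <= 1.
Proof.
have := unitI_ge0 t; have := unitI_le1 t; move: (unitI_val t) => x x1 x0.
apply/andP; split.
  by rewrite le_min mulr_ge0//=; lra.
by rewrite ge_min; apply/orP; right; lra.
Qed.

Lemma delay_continuous n : continuous (delay n).
Proof.
apply: clamp_comp_continuous => t.
apply: (@continuous_min R I (fun t => n.+1%:R * unitI_val t)
  (fun t => 2^-1 * unitI_val t + 2^-1)).
  exact: Defs.scale_continuous (@unitI_val_continuous R) t.
exact: affine_continuous (@unitI_val_continuous R) t.
Qed.

Lemma delay0 n : delay n zero = zero.
Proof.
by apply: unitI_inj; rewrite clampK ?delay_bound// val_zero !mulr0 min_l//; lra.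
Qed.

Lemma delay1 n : delay n one = one.
Proof.
apply: unitI_inj; rewrite clampK ?delay_bound// val_one !mulr1 min_r; first lra.
by rewrite (_ : 2^-1 + 2^-1 = 1) ?ler1n//; lra.
Qed.

Lemma path_cat_delay_late n a b t : 1 <= n.+1%:R * unitI_val t ->
  path_cat b a (delay n t) = a t.
Proof.
have := unitI_ge0 t; have := unitI_le1 t => x1 x0 late.
rewrite /path_cat (clampK (delay_bound n t)) min_r; last by lra.
have tgt0 : 0 < unitI_val t.
  by rewrite lt_def x0 andbT; apply: contraTneq late => ->; lra.
rewrite ifF; last by apply/negbTE; rewrite -ltNge; lra.
by rewrite -[in RHS](unitI_valK t); congr (a (clamp _)); lra.
Qed.

Lemma path_cat_delay n a b t :
  range b (path_cat b a (delay n t)) \/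
  exists2 s, unitI_val s <= unitI_val t & path_cat b a (delay n t) = a s.
Proof.
rewrite /path_cat (clampK (delay_bound n t)); case: leP => h; [left|right].
  by eexists.
eexists; last by [].
have q2 : Num.min (n.+1%:R * unitI_val t) (2^-1 * unitI_val t + 2^-1)
  <= 2^-1 * unitI_val t + 2^-1 by rewrite ge_min lexx orbT.
have := delay_bound n t.
by move: q2 h; set q := Num.min _ _ => q2 h q01; rewrite clampK; lra.
Qed.

Lemma path_cat_delay_homotopic n a b : continuous a -> continuous b ->
  b one = a zero -> path_homotopic (path_cat b a \o delay n) (path_cat b a).
Proof.
move=> ca cb ba.
change (path_homotopic (path_cat b a \o delay n) (path_cat b a \o id)).
apply: path_homotopic_reparam.
- exact: path_cat_continuous.
- exact: delay_continuous.
- by move=> t; exact: cvg_id.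
- exact: delay0.
- exact: delay1.
Qed.

Lemma nbhs_zero_interval (P : set I) : nbhs (zero : I) P ->
  exists2 e : R, 0 < e & forall t, unitI_val t < e -> P t.
Proof.
move=> /(@clamp_continuous R 0) /nbhs_ballP[e e0 eP].
exists e => // t te; rewrite -(unitI_valK t); apply: eP.
by rewrite /ball/= sub0r normrN ger0_norm ?unitI_ge0.
Qed.

Lemma compact_away_zero (K : set I) : compact K -> ~ K zero ->
  exists2 e : R, 0 < e & forall t, unitI_val t < e -> ~ K t.
Proof.
move=> cK K0.
have cKv : closed (@unitI_val R @` K).
  apply: compact_closed; first exact: norm_hausdorff.
  apply: continuous_compact => //.
  exact/continuous_subspaceT/unitI_val_continuous.
have : nbhs (zero : I) (@unitI_val R @^-1` (~` (@unitI_val R @` K))).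
  apply: unitI_val_continuous; apply: open_nbhs_nbhs; split.
    exact: closed_openC.
  by move=> [t Kt] /unitI_inj t0; apply: K0; rewrite -t0.
move=> /nbhs_zero_interval[e e0 eP]; exists e => // t te Kt.
by apply: (eP _ te); exists t.
Qed.

(** The sets that contain [path_cat b a \o delay n] for all [b] in some
    neighborhood of [a zero] and all large [n] form a filter, and the claim is that it converges to
    [a]; for a filter this can be tested on the subbase of the compact-open
    topology. If the compact [K] contains 0, then [O] is itself a neighborhood
    of the base point and serves as [V]. Otherwise [K] stays away from 0, and
    fast delayed paths coincide with [a] on [K]. *)
Lemma nbhs_delayed_cat a (C : set {compact-open, I -> X}) :
  continuous a -> open C -> C a ->
  exists2 V, nbhs (a zero) V & exists n,
    forall b, range b `<=` V -> C (path_cat b a \o delay n).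
Proof.
move=> ca oC Ca.
pose F : set_system {compact-open, I -> X} := fun N =>
  exists2 V, nbhs (a zero) V & \forall n \near \oo, forall b,
    range b `<=` V -> N (path_cat b a \o delay n).
have FF : Filter F.
  split.
  - by exists setT; [exact: filterT|exact: nearW].
  - move=> P Q [V nV VP] [W nW WQ]; exists (V `&` W); first exact: filterI.
    apply: filterS2 VP WQ => n Pn Qn b bVW.
    by split; [apply: Pn|apply: Qn] => x /bVW[].
  - move=> P Q PQ [V nV VP]; exists V => //.
    by apply: filterS VP => n Pn b bV; exact/PQ/Pn.
suff [V nV [n _ nC]] : F C by exists V => //; exists n; exact: nC (leqnn n).
suff Fa : F --> (a : {compact-open, I -> X}).
  by apply: Fa; exact: open_nbhs_nbhs.
apply/compact_open_cvgP => K O cK oO aKO.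
have late e : 0 < e -> \forall n \near \oo, forall t,
    e <= unitI_val t -> 1 <= n.+1%:R * unitI_val t.
  move=> e0; near=> n => t et.
  have ne : n.+1%:R^-1 < e by near: n; exact: (near_infty_natSinv_lt (PosNum e0)).
  rewrite -ler_pdivrMl ?ltr0n// mulr1; exact: le_trans (ltW ne) et.
have [K0|K0] := pselect (K zero).
  have Oa : nbhs (a zero) O.
    by apply: open_nbhs_nbhs; split=> //; apply: aKO; exists zero.
  have [e e0 eO] := nbhs_zero_interval (ca _ _ Oa).
  exists O => //; apply: filterS (late e e0) => n nlate b bO _ [t Kt <-] /=.
  have [te|et] := ltP (unitI_val t) e.
    have [/bO//|[s st ->]] := path_cat_delay n a b t.
    exact/eO/(le_lt_trans st).
  by rewrite (path_cat_delay_late _ _ (nlate t et)); apply: aKO; exists t.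
have [e e0 eK] := compact_away_zero cK K0.
exists setT; first exact: filterT.
apply: filterS (late e e0) => n nlate b _ _ [t Kt <-] /=.
have [/eK//|et] := ltP (unitI_val t) e.
by rewrite (path_cat_delay_late _ _ (nlate t et)); apply: aKO; exists t.
Unshelve. all: by end_near.
Qed.

End DelayedPath.

(** * The two topologies on homotopy classes *)

Section ClassTopologies.
Context (R : realType) (X : topologicalType) (x0 : X).
Local Notation I := (unitI R).

Lemma whisker_ball_open (f : based_path R x0) (U : set X) :
  open U -> U (based_fun f one) -> @open (universal_wh R x0) (whisker_ball f U).
Proof.
move=> oU Uf; exists [set (f, U)]; first by move=> _ ->.
by rewrite bigcup_set1.
Qed.

(** The quotient, subspace and path space topologies are all pulled back or
    pushed forward along canonical maps, so an open set of classes is seen on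
    path representatives as an open set of functions. *)
Lemma universal_top_open (A : set (homotopy_class R x0)) :
  @open (universal_top R x0) A ->
  exists2 C : set {compact-open, I -> X}, open C &
    forall f : based_path R x0, A (class_of f) <-> C (based_fun f).
Proof.
move=> [B [C oC <-] BA]; exists C => // f.
by rewrite -[A _]/((_ @^-1` A) f) -BA.
Qed.

End ClassTopologies.

Theorem theorem4p11 (R : realType) (X : topologicalType)
    (top_eq_wh : forall x0 : X,
      (@open (universal_top R x0) : set (set (homotopy_class R x0))) =
      @open (universal_wh R x0)) :
  small_loop_transfer R X.
Proof.
move=> x0 x1 alpha U; rewrite nbhsE => -[W [oW Wx0] WU].
have calpha : continuous alpha by exact: cts_fun.
have alpha0 : alpha zero = x0 by exact: path_zero.
have alpha1 : alpha one = x1 by exact: path_one.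
have crev := path_rev_continuous calpha.
have rev0 : path_rev alpha zero = x1 by rewrite path_rev0.
have rev1 : path_rev alpha one = x0 by rewrite path_rev1.
pose a := mk_based crev rev0.
have Wa : W (based_fun a one) by rewrite mk_basedE rev1.
have := whisker_ball_open oW Wa.
rewrite -top_eq_wh => /universal_top_open[C oC CE].
have Ca : C (path_rev alpha) by apply/(CE a)/whisker_ball_center.
have [V nV [n nVC]] := nbhs_delayed_cat crev oC Ca.
exists V; first by rewrite -rev0.
move=> beta bV; have cbeta : continuous beta by exact: cts_fun.
have beta0 : beta zero = x1 by exact: path_zero.
have beta1 : beta one = x1 by exact: path_one.
have beta_rev : beta one = path_rev alpha zero by rewrite rev0.
have cdelayed : continuous (path_cat beta (path_rev alpha) \o delay n).
  apply: comp_continuous (path_cat_continuous cbeta crev beta_rev).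
  exact: delay_continuous.
have delayed0 : (path_cat beta (path_rev alpha) \o delay n) zero = x1.
  by rewrite /= delay0 path_cat0.
have /CE[y [g [gW /class_of_eq]]] :
  C (based_fun (mk_based cdelayed delayed0)) by exact: nVC _ bV.
rewrite !mk_basedE => hom.
have g0 : g zero = x0 by rewrite path_zero.
have g1 : g one = x0.
  by have := path_homotopic1 hom; rewrite path_cat1 /= delay1 path_cat1 rev1.
have cg : continuous g by exact: cts_fun.
exists (mk_path cg g0 g1); first exact: subset_trans gW WU.
apply: path_homotopic_transfer => //; rewrite ?alpha1 ?alpha0//.
apply: path_homotopic_trans hom.
exact/path_homotopic_sym/path_cat_delay_homotopic.
Qed.
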